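(* Let $\mathbb{F}$ be any field and let $d\ge 2$ be an integer. If $\mathcal L$ is a set of $L$ lines in $\mathbb{F}^d$, then the number of joints formed by $\mathcal L$ is at most \[ \frac{(d-1)!^{1/(d-1)}}{d}\, L^{d/(d-1)}. \]
   Context: Given a set $\mathcal L$ of lines in $\mathbb{F}^d$, a joint is a point of $\mathbb{F}^d$ through which pass $d$ lines of $\mathcal L$ that do not all lie in a common hyperplane (i.e. whose directions are linearly independent). Each such point is counted once, even if more than $d$ lines of $\mathcal L$ pass through it. *)

(* Defs.v *)
From HB Require Import structures.
From mathcomp Require Import all_boot all_order all_algebra.
From mathcomp Require Import all_classical all_reals all_analysis.

Set Implicit Arguments.
Unset Strict Implicit.
Unset Printing Implicit Defensive.

Import Order.TTheory GRing.Theory Num.Theory.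

Local Open Scope classical_set_scope.
Local Open Scope ring_scope.

Definition is_flat (F : fieldType) (d k : nat) (A : set 'rV[F]_d) : Prop :=
  exists (p : 'rV[F]_d) (U : {vspace 'rV[F]_d}),
    \dim U = k /\ A = [set x | x - p \in U].

Definition is_line (F : fieldType) (d : nat) (A : set 'rV[F]_d) : Prop :=
  is_flat 1 A.

Definition is_hyperplane (F : fieldType) (d : nat) (A : set 'rV[F]_d) : Prop :=
  is_flat d.-1 A.

(* For lines through a common point, lying in no common hyperplane amounts to
   having linearly independent directions. *)
Definition is_joint (F : fieldType) (d : nat) (Lines : set (set 'rV[F]_d))
    (p : 'rV[F]_d) : Prop :=
  exists l : 'I_d -> set 'rV[F]_d,
    [/\ injective l,
        forall i, Lines (l i),
        forall i, l i p
      & ~ exists2 H : set 'rV[F]_d, is_hyperplane H & forall i, l i `<=` H].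

Definition joints (F : fieldType) (d : nat) (Lines : set (set 'rV[F]_d)) :
    set 'rV[F]_d :=
  [set p | is_joint Lines p].

(* Main.v *)
(* The polynomial method with unequal vanishing orders (Zhang, Yu and Zhao).
   Give each joint p a handicap u p. On a line l with joints q, let K be largest
   with sum_q (K - u q)^+ <= n, and let b p l = (K + 1 - u p)^+, so that
   sum_p b p l is at most n plus the number of joints. If a polynomial f of degree
   at most n has, at each joint p and in coordinates along d independent lines l_i
   through p, no monomial x^gamma with gamma_i < b p l_i for all i, then f = 0.
   Indeed, at a joint p minimising (multiplicity of f at p) + u p take a monomial
   gamma of least degree; some gamma_i >= b p l_i, and the coefficient of the
   monomial in the variables other than x_i is a nonzero univariate polynomial
   along l_i of degree at most n, which vanishes at each joint q of l_i to order at
   least gamma_i + u p - u q: altogether more than n zeros. Counting dimensions,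
   'C(n + d, d) <= sum_p prod_i b p l_i.

   If the joints are connected by the lines, u can be chosen to make all these
   products at most about their geometric mean, which AM-GM bounds by
   (L n / (d m))^d for m joints and L lines. Letting n grow gives
   d^d m^(d-1) <= d! L^d, and this inequality is superadditive over connected
   components. *)
Require Import Defs.
From HB Require Import structures.
From mathcomp Require Import all_boot all_order all_algebra zify.

Set Implicit Arguments.
Unset Strict Implicit.
Unset Printing Implicit Defensive.

Import Order.TTheory GRing.Theory Num.Theory.

(** * Inequalities between natural numbers *)

Lemma card_ord_lt n b : #|[pred k : 'I_n | k < b]| <= b.
Proof.
rewrite cardE -(size_map val) -[leqRHS](size_iota 0); apply: uniq_leq_size.
  by rewrite map_inj_uniq ?enum_uniq //; apply: val_inj.
by move=> _ /mapP [k + ->]; rewrite mem_enum mem_iota.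
Qed.

Lemma leq_expl k m n : m <= n -> m ^ k <= n ^ k.
Proof. by case: k => // k; rewrite leq_exp2r. Qed.

Lemma expnD_le m k :
  exists D, forall n, 0 < n -> (n + m) ^ k.+1 <= n ^ k.+1 + D * n ^ k.
Proof.
elim: k => [|k [D IH]]; first by exists m => n _; rewrite !expn1 expn0 muln1.
exists (D + m + m * D) => n n0; rewrite expnS.
apply: leq_trans (leq_mul (leqnn _) (IH n n0)) _.
have : n ^ k <= n ^ k.+1 by rewrite leq_pexp2l.
rewrite [n ^ k.+2]expnS [in _ * (n ^ k.+1)]expnS; have := expnS n k; nia.
Qed.

(** If [B < A], the surplus [n ^ k.+1] outgrows the remaining terms, which are of order [n ^ k]. *)
Lemma leq_leading_coef A B C m k :
  (forall n, A * n ^ k.+1 <= B * (n + m) ^ k.+1 + C * n.+1 ^ k) -> A <= B.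
Proof.
move=> h; rewrite leqNgt; apply/negP => lt.
have [D hD] := expnD_le m k.
pose n := (B * D + C * 2 ^ k).+1.
have n2 : n.+1 ^ k <= 2 ^ k * n ^ k by rewrite -expnMn leq_expl //; lia.
have a0 : 0 < n ^ k by rewrite expn_gt0.
have h1 : B * (n + m) ^ k.+1 <= B * (n ^ k.+1 + D * n ^ k).
  by rewrite leq_mul2l hD ?orbT.
have h2 : C * n.+1 ^ k <= C * (2 ^ k * n ^ k) by rewrite leq_mul2l n2 orbT.
have h3 : B.+1 * n ^ k.+1 <= A * n ^ k.+1 by rewrite leq_mul2r lt orbT.
have := leq_trans h3 (leq_trans (h n) (leq_add h1 h2)).
rewrite expnS => h4; have : n * n ^ k <= (B * D + C * 2 ^ k) * n ^ k by lia.
by rewrite leq_pmul2r // ltnn.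
Qed.

(** By symmetry let [a / x] be the larger ratio. Then [(a + b) / (x + y)] is at most [a / x], and
    the bound for [a] and [x] alone suffices. *)
Lemma merge_bound C K a b x y k : 0 < x -> 0 < y ->
  C * a ^ k <= K * x ^ k.+1 -> C * b ^ k <= K * y ^ k.+1 ->
  C * (a + b) ^ k <= K * (x + y) ^ k.+1.
Proof.
wlog le : a b x y / b * x <= a * y => [H|] x0 y0 ha hb.
  have [/H|/ltnW] := leqP (b * x) (a * y); first exact.
  by rewrite mulnC [leqRHS]mulnC mulnC [leqRHS]mulnC addnC (addnC x) => /H; apply.
have xk : 0 < x ^ k by rewrite expn_gt0 x0.
rewrite -(leq_pmul2r xk) -mulnA -expnMn.
have /(leq_expl k) : (a + b) * x <= a * (x + y) by rewrite mulnDl mulnDr leq_add2l.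
rewrite [leqRHS]expnMn => {}le.
apply: leq_trans (leq_mul (leqnn C) le) _; rewrite mulnA.
apply: leq_trans (leq_mul ha (leqnn _)) _.
have := leq_mul (leqnn K) (leq_mul (leq_addr y x) (leqnn (x ^ k * (x + y) ^ k))).
by rewrite !expnS; lia.
Qed.

Lemma prod_le_add (I : Type) (s : seq I) (x y : I -> nat) N :
  (forall i, x i <= N) -> (forall i, y i <= N) -> (forall i, x i <= (y i).+1) ->
  \prod_(i <- s) x i <= \prod_(i <- s) y i + size s * N ^ (size s).-1.
Proof.
move=> xN yN xy; elim: s => [|i s IH]; first by rewrite !big_nil.
rewrite !big_cons /=; have XN : \prod_(j <- s) x j <= N ^ size s.
  elim: s {IH} => [|j s IH]; first by rewrite big_nil.
  by rewrite big_cons expnS leq_mul.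
have SN : N * (size s * N ^ (size s).-1) <= size s * N ^ size s.
  by case: (size s) => [|k] /=; rewrite ?expnS; lia.
apply: leq_trans (leq_mul (xy i) (leqnn _)) _; rewrite mulSn addnC.
apply: leq_trans (leq_add (leq_mul (leqnn _) IH) XN) _.
rewrite mulnDr mulSn -!addnA leq_add2l addnC leq_add2l.
by apply: leq_trans SN; rewrite leq_mul2r yN orbT.
Qed.

Lemma AGM_nat (A : finType) (P : {pred A}) (E : A -> nat) :
  #|P| ^ #|P| * \prod_(i in P) E i <= (\sum_(i in P) E i) ^ #|P|.
Proof.
have [i _|+ _] := @leif_AGM_scaled int A P (fun i => (E i)%:R)%R.
  by rewrite mulrn_wge0.
by rewrite prodrMn_const -natr_sum -natr_prod -mulr_natr -natrM -natrX ler_nat mulnC.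
Qed.

Lemma AGM_uniform (J : finType) (T : {set J}) d (c : J -> 'I_d -> nat) w X :
  T != set0 -> (forall p, p \in T -> w <= \prod_i c p i) ->
  \sum_(p in T) \sum_i c p i <= X -> (d * #|T|) ^ d * w <= X ^ d.
Proof.
rewrite -card_gt0 => T0 hw hX.
pose P : {pred J * 'I_d} := fun x => x.1 \in T.
have sumP (F : J -> 'I_d -> nat) :
    \sum_(x in P) F x.1 x.2 = \sum_(p in T) \sum_i F p i.
  by rewrite pair_big_dep; apply: eq_bigl => x; rewrite andbT.
have prodP : \prod_(x in P) c x.1 x.2 = \prod_(p in T) \prod_i c p i.
  by rewrite pair_big_dep; apply: eq_bigl => x; rewrite andbT.
have cardP : #|P| = d * #|T|.
  rewrite -(sum1_card P); transitivity (\sum_(p in T) \sum_(i < d) 1).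
    exact: (sumP (fun _ _ => 1)).
  under eq_bigr do rewrite sum1_card card_ord.
  by rewrite sum_nat_const mulnC.
have := AGM_nat P (fun x => c x.1 x.2); rewrite cardP sumP prodP => AGM.
(* AM-GM over all [d * #|T|] factors gives the claim raised to the power [#|T|]. *)
rewrite -(leq_exp2r _ _ T0) expnMn -!expnM.
apply: leq_trans (leq_trans AGM (leq_expl _ hX)).
by rewrite leq_mul // -prod_nat_const leq_prod.
Qed.

(** * Handicaps and the conditions they impose *)

Section Greedy.
Variables (d : nat) (J I : finType) (e : J -> 'I_d -> I).
Hypothesis e_inj : forall p, injective (e p).

(** Only the [d] lines chosen for [q] count: a line may pass through [q] without satisfying
    [on_line]. *)
Definition on_line (l : I) (q : J) := [exists j, e q j == l].
Definition lines_of (T : {set J}) : {set I} := [set l | [exists q in T, on_line l q]].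

(* With [K] the largest [k] such that [fill T u l k <= n], [conds T n u l p] is the
   truncated [K + 1 - u p]. *)
Definition fill (T : {set J}) (u : J -> nat) l k :=
  \sum_(q in T | on_line l q) (k - u q).
Definition conds (T : {set J}) n u l p := \sum_(r < n.+1) (fill T u l (r + u p) <= n).

Lemma on_lineP p i : on_line (e p i) p.
Proof. by apply/existsP; exists i. Qed.

Section Fixed.
Variables (T : {set J}) (n : nat).
Local Notation m := #|T|.
Implicit Types (u : J -> nat) (l : I) (p q : J).

Lemma conds_le u l p : conds T n u l p <= n.+1.
Proof.
rewrite -[leqRHS]card_ord -sum1_card; apply: leq_sum => r _; exact: leq_b1.
Qed.

Lemma leq_fill u l k k' : k <= k' -> fill T u l k <= fill T u l k'.
Proof. by move=> le; apply: leq_sum => q _; apply: leq_sub2r. Qed.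

Lemma leq_fill_on u l k q : q \in T -> on_line l q -> k - u q <= fill T u l k.
Proof. by move=> qT lq; rewrite /fill (bigD1 q) /= ?qT // leq_addr. Qed.

(** [fill] is monotone in [k], so the counted [r] form an initial segment, of length
    [conds T n u l p]. *)
Lemma conds_full u l p r : p \in T -> on_line l p ->
  conds T n u l p <= r -> n < fill T u l (r + u p).
Proof.
move=> pT lp cr; rewrite ltnNge; apply/negP => le.
move: cr; apply/negP; rewrite -ltnNge.
(* The joint [p] itself contributes [r] to [fill], so the cut-off at [n] loses nothing. *)
have rn : r < n.+1.
  by apply: leq_trans le; rewrite -{1}(addnK (u p) r) leq_fill_on.
have : \sum_(k < n.+1) (k < r.+1) <= conds T n u l p.
  apply: leq_sum => k _; case: ltnP => //= kr; rewrite lt0b.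
  by apply: leq_trans (leq_fill _ _ _) le; rewrite leq_add2r.
apply: leq_trans; rewrite -big_mkcond /= -(big_ord_widen _ (fun=> 1)) //.
by rewrite sum1_card card_ord.
Qed.

Lemma conds_near u l p q : 0 < conds T n u l p -> q \in T -> on_line l q ->
  u p <= u q + n.
Proof.
rewrite lt0n sum_nat_eq0 => /forallPn [r /=]; rewrite eqb0 negbK => le qT lq.
have := leq_trans (leq_fill_on u (r + u p) qT lq) le; lia.
Qed.

Lemma sum_conds_line u l : \sum_(p in T | on_line l p) conds T n u l p <= n + m.
Proof.
have [p0 /andP[p0T p0l]|none] := pickP (fun p => (p \in T) && on_line l p); last first.
  by rewrite big_pred0.
have K_ex : exists k, fill T u l k <= n.
  by exists 0; rewrite /fill big1.
have K_bd k : fill T u l k <= n -> k <= n + u p0.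
  by move/(leq_trans (leq_fill_on u k p0T p0l)); lia.
case: (ex_maxnP K_ex K_bd) => K fK maxK.
apply: (@leq_trans (fill T u l K + \sum_(p in T | on_line l p) 1)); last first.
  rewrite leq_add // sum1_card; apply/subset_leq_card/subsetP => p.
  by case/andP.
rewrite -big_split; apply: leq_sum => p _ /=.
apply: (@leq_trans (\sum_(r < n.+1) (r < K - u p + 1))).
  apply: leq_sum => r _; case: (leqP (fill T u l (r + u p)) n) => // /maxK.
  by case: (ltnP r (K - u p + 1)) => //=; lia.
by rewrite -big_mkcond sum1_card card_ord_lt.
Qed.

Lemma sum_conds u :
  \sum_(p in T) \sum_i conds T n u (e p i) p <= #|lines_of T| * (n + m).
Proof.
rewrite -sum_nat_const.
rewrite (eq_bigr (fun p => \sum_(l in lines_of T | on_line l p) conds T n u l p)).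
  rewrite (exchange_big_dep (mem (lines_of T))) /= => [|p l _ /andP[]//].
  apply: leq_sum => l lT; apply: leq_trans (sum_conds_line u l).
  by apply/eq_leq/eq_bigl => p; rewrite lT.
move=> p pT; rewrite -(big_imset (conds T n u ^~ p) (in2W (@e_inj p) : {in predT &, _})).
apply: eq_bigl => l; apply/imsetP/andP => [[i _ ->]|[_ /existsP[i /eqP]]].
  rewrite on_lineP inE; split => //; apply/existsP; exists p.
  by rewrite pT on_lineP.
by exists i.
Qed.

Lemma conds_incr_other u u' l p : (forall q, u q <= u' q) -> u' p = u p ->
  conds T n u l p <= conds T n u' l p.
Proof.
move=> le eq; apply: leq_sum => r _; rewrite eq.
case: (leqP (fill T u l _) n) => // h; rewrite lt0b; apply: leq_trans h.
by apply: leq_sum => q _; apply: leq_sub2l.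
Qed.

(** The term [r] for [u'] dominates the term [r.+1] for [u], so at most the term [r = 0] is lost. *)
Lemma conds_incr_self u u' l p : (forall q, u q <= u' q) -> u' p = (u p).+1 ->
  conds T n u l p <= (conds T n u' l p).+1.
Proof.
move=> le eq; rewrite /conds big_ord_recl [in leqRHS]big_ord_recr /=.
rewrite -(add1n (_ + _)) leq_add ?leq_b1 //; apply: leq_trans (leq_addr _ _).
apply: leq_sum => r _; rewrite eq addnS; case: (leqP (fill T u l _) n) => // h.
rewrite lt0b; apply: leq_trans h; apply: leq_sum => q _.
by apply: leq_sub2l.
Qed.

(* Among the [u] such that every joint with [u p > 0] still has a product above [W],
   take one of largest total. It exists: by AM-GM some [u p] vanishes, and [u]
   differs by at most [n] along a line that still counts at the higher joint, so
   connectedness bounds [u]. If some product were much larger than [W], raising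
   that [u p] by one would be allowed, since it costs only one unit in each
   [conds T n u (e p i) p] and decreases no other. *)
Lemma balanced_handicaps (W : nat) :
  (forall S : {set J}, S \subset T -> S != set0 -> S != T ->
     exists p q i, [/\ p \in T :\: S, q \in S & on_line (e p i) q]) ->
  T != set0 -> (#|lines_of T| * (n + m)) ^ d < (d * m) ^ d * W.+1 ->
  exists u : J -> nat, forall p, p \in T ->
    \prod_i conds T n u (e p i) p <= W + d * n.+1 ^ d.-1.
Proof.
move=> conn T0 hW; set U := (m * n).+2.
pose nv (u : {ffun J -> 'I_U}) p : nat := u p.
pose inv (u : {ffun J -> 'I_U}) :=
  [forall p in T, (0 < nv u p) ==> (W < \prod_i conds T n (nv u) (e p i) p)].
have zero (u : {ffun J -> 'I_U}) : inv u -> exists2 p, p \in T & nv u p = 0.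
  move=> /forall_inP hu; apply/exists_eq_inP; apply: contraTT hW => /exists_inPn npos.
  rewrite -leqNgt; apply: AGM_uniform (sum_conds _) => // p pT.
  by apply: (implyP (hu p pT)); rewrite lt0n npos.
have bound (u : {ffun J -> 'I_U}) p : inv u -> p \in T -> nv u p <= m * n.
  move=> hu pT; have [p0 p0T up0] := zero u hu.
  (* While [S k] is not [T], connectedness gives a joint outside it within [n] of one inside, so
     [S k.+1] is larger; after [m] steps [T] is exhausted. *)
  pose S k := [set q in T | nv u q <= k * n].
  have ST k : S k \subset T by apply/subsetP => q; rewrite inE => /andP[].
  have cardS k : minn k.+1 m <= #|S k|.
    elim: k => [|k IH].
      rewrite (leq_trans (geq_minl _ _)) // card_gt0; apply/set0Pn; exists p0.
      by rewrite inE p0T up0.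
    have SS : S k \subset S k.+1.
      apply/subsetP => q; rewrite !inE => /andP[-> le] /=.
      by rewrite (leq_trans le) // leq_mul2r leqnSn orbT.
    have [ST_eq|neq] := eqVneq (S k) T.
      by apply: leq_trans (geq_minr _ _) _; rewrite -{1}ST_eq subset_leq_card.
    have S0 : S k != set0.
      by apply/set0Pn; exists p0; rewrite inE p0T up0.
    have [q [r [i [/setDP[qT qS] rS qr]]]] := conn _ (ST k) S0 neq.
    have qS' : q \in S k.+1.
      move: qS rS; rewrite !inE qT /= -ltnNge => qk /andP[rT rk].
      have pos : 0 < conds T n (nv u) (e q i) q.
        have := implyP (forall_inP hu q qT) (leq_ltn_trans (leq0n _) qk).
        rewrite (bigD1 i) //=; case: (conds _ _ _ _ _) => //.
      by rewrite (leq_trans (conds_near pos rT qr)) // mulSn addnC leq_add2l.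
    have : S k \proper S k.+1 by apply/properP; split => //; exists q.
    move/proper_card/(leq_ltn_trans IH); apply: leq_trans.
    by rewrite -minnSS leq_min geq_minl /= leqW // geq_minr.
  have /eqP Sm : S m == T.
    by rewrite eqEcard ST (leq_trans _ (cardS m)) // leq_min leqnSn leqnn.
  by move: pT; rewrite -{1}Sm inE => /andP[].
have inv0 : inv [ffun=> ord0] by apply/forall_inP => p _; rewrite /nv ffunE.
have [u uinv umax] := arg_maxnP (fun u : {ffun J -> 'I_U} => \sum_(p in T) nv u p) inv0.
exists (nv u) => p pT; rewrite leqNgt; apply/negP => big.
have lt_U : (nv u p).+1 < U by rewrite !ltnS bound.
pose u' : {ffun J -> 'I_U} := [ffun q => if q == p then Ordinal lt_U else u q].
have u'E q : nv u' q = (q == p) + nv u q.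
  by rewrite /nv ffunE; case: eqP => [->|].
have uu' q : nv u q <= nv u' q by rewrite u'E leq_addl.
suff : inv u'.
  move=> /umax le; have : \sum_(q in T) nv u' q <= \sum_(q in T) nv u q by exact: le.
  rewrite (bigD1 p) //= [leqRHS](bigD1 p) //= u'E eqxx.
  rewrite (eq_bigr (nv u)) => [|q /andP[_ /negPf qp]]; last by rewrite u'E qp.
  by rewrite add1n addSn ltnn.
apply/forall_inP => q qT; apply/implyP => u'q.
have [qp|/negPf qp] := eqVneq q p; last first.
  rewrite u'E qp in u'q; apply: leq_trans (implyP (forall_inP uinv q qT) u'q) _.
  by apply: leq_prod => i _; apply: conds_incr_other => //; rewrite u'E qp.
(* Raising [u p] costs the product at [p] at most [d * n.+1 ^ d.-1], less than its surplus over
   [W]. *)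
rewrite qp; have := @prod_le_add _ (enum 'I_d) (fun i => conds T n (nv u) (e p i) p)
  (fun i => conds T n (nv u') (e p i) p) n.+1.
rewrite !big_enum size_enum_ord => /(_ _ _ _) H.
rewrite -(ltn_add2r (d * n.+1 ^ d.-1)); apply: leq_trans big _; apply: H => i.
- exact: conds_le.
- exact: conds_le.
- by apply: conds_incr_self => //; rewrite u'E eqxx.
Qed.
End Fixed.

(** * From the dimension count to the bound on joints *)

Hypothesis d_gt0 : 0 < d.
(** The polynomial method enters this section only here; [Polynomials.binomial_le_sum_prod] supplies
    it. *)
Hypothesis dimension_bound : forall (T : {set J}) n (u : J -> nat) (b : J -> 'I_d -> nat),
  T != set0 ->
  (forall p i r, p \in T -> b p i <= r ->
     n < \sum_(q in T | on_line (e p i) q) (r + u p - u q)) ->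
  'C(n + d, d) <= \sum_(p in T) \prod_i b p i.

Lemma connected_joints_bound (T : {set J}) : T != set0 ->
  (forall S : {set J}, S \subset T -> S != set0 -> S != T ->
     exists p q i, [/\ p \in T :\: S, q \in S & on_line (e p i) q]) ->
  d ^ d * #|T| ^ d.-1 <= d`! * #|lines_of T| ^ d.
Proof.
move=> T0 conn; set m := #|T|; set l := #|lines_of T|.
have m0 : 0 < m by rewrite card_gt0.
rewrite -(leq_pmul2r m0) -mulnA -expnSr prednK // -expnMn.
apply: (@leq_leading_coef _ _ (d`! * (d * m) ^ d * m * d) m d.-1) => n.
(* The AM-GM bound on the products, rounded down, so that [W.+1] exceeds it strictly. *)
rewrite prednK //; pose W := (l * (n + m)) ^ d %/ (d * m) ^ d.
have A0 : 0 < (d * m) ^ d by rewrite expn_gt0 muln_gt0 d_gt0 m0.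
have [|u hu] := @balanced_handicaps T n W conn T0.
  by rewrite [ltnRHS]mulnC -ltn_divLR.
have binom : 'C(n + d, d) <= m * (W + d * n.+1 ^ d.-1).
  apply: leq_trans (dimension_bound (u := u)
    (b := fun p i => conds T n u (e p i) p) T0 _) _.
    by move=> p i r pT; apply: conds_full => //; apply: on_lineP.
  by rewrite -sum_nat_const leq_sum.
have nd : n ^ d <= d`! * 'C(n + d, d).
  rewrite mulnC bin_ffact ffact_prod -[X in _ ^ X]card_ord -prod_nat_const.
  by apply: leq_prod => i _; have := ltn_ord i; lia.
have WA : W * (d * m) ^ d <= (l * (n + m)) ^ d by apply: leq_trunc_div.
have h1 := leq_mul (leqnn ((d * m) ^ d)) nd.
have h2 := leq_mul (leqnn ((d * m) ^ d)) (leq_mul (leqnn d`!) binom).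
have h3 := leq_mul (leqnn (d`! * m)) WA.
apply: leq_trans h1 (leq_trans h2 _); move: h3; rewrite [(l * _) ^ d]expnMn.
lia.
Qed.

(** Induction on the number of joints. If some [S] shares no chosen line with its complement, the
    two parts use disjoint sets of lines and [merge_bound] combines their bounds; otherwise [T] is
    connected. *)
Lemma joints_bound (T : {set J}) :
  T != set0 -> d ^ d * #|T| ^ d.-1 <= d`! * #|lines_of T| ^ d.
Proof.
have [k] := ubnP #|T|; elim: k T => // k IH T /ltnSE Tk T0.
have lines0 (S : {set J}) : S != set0 -> 0 < #|lines_of S|.
  case/set0Pn => p pS; rewrite card_gt0; apply/set0Pn.
  exists (e p (Ordinal d_gt0)); rewrite inE; apply/existsP; exists p.
  by rewrite pS on_lineP.
have [/existsP[S /and4P[ST S0 SnT sep]]|conn] := boolP [exists S : {set J},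
  [&& S \subset T, S != set0, S != T &
      [forall p in T :\: S, forall q in S, forall i, ~~ on_line (e p i) q]]].
- have TS0 : T :\: S != set0.
    by apply: contraNneq SnT => /eqP; rewrite setD_eq0 eqEsubset ST.
  have cT : #|T| = #|S| + #|T :\: S|.
    by rewrite -(cardsID S T) (setIidPr ST).
  have cS : #|S| < k.
    by apply: leq_trans Tk; rewrite cT -addn1 leq_add2l card_gt0.
  have cTS : #|T :\: S| < k.
    by apply: leq_trans Tk; rewrite cT -add1n leq_add2r card_gt0.
  have := merge_bound (lines0 _ S0) (lines0 _ TS0) (k := d.-1).
  rewrite prednK // => /(_ _ _ _ _ (IH S cS S0) (IH _ cTS TS0)); rewrite -cT.
  move/leq_trans; apply; rewrite leq_mul2l leq_expl ?orbT //.
  have dis : [disjoint lines_of S & lines_of (T :\: S)].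
    rewrite -setI_eq0; apply/eqP/setP => l; rewrite !inE; apply/negP.
    case/andP => /exists_inP[q qS ql] /exists_inP[p pTS /existsP[i /eqP pl]].
    have /forall_inP/(_ q qS)/forallP/(_ i) := forall_inP sep p pTS.
    by rewrite pl ql.
  have [_] := leq_card_setU (lines_of S) (lines_of (T :\: S)); rewrite dis => /eqP <-.
  apply/subset_leq_card/subsetP => l; rewrite !inE => /orP[] /exists_inP[p pS pl].
    by apply/exists_inP; exists p => //; apply: (subsetP ST).
  by apply/exists_inP; exists p => //; case/setDP: pS.
- apply: connected_joints_bound => // S ST S0 SnT.
  move: conn; rewrite negb_exists => /forallP/(_ S); rewrite ST S0 SnT /=.
  rewrite negb_forall => /existsP [p]; rewrite negb_imply => /andP[pTS].
  rewrite negb_forall => /existsP [q]; rewrite negb_imply => /andP[qS].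
  by rewrite negb_forall => /existsP [i /negPn h]; exists p, q, i.
Qed.
End Greedy.

Local Open Scope ring_scope.

(* The notations of [mpoly] clash with those of mathcomp-analysis; the module
   confines them. *)
Module Polynomials.
From mathcomp Require Import mpoly.

(** * Degrees of monomials under substitution *)

Section MonomialRelation.
Variables (F : fieldType) (d : nat) (rel : nat -> nat -> Prop).
Hypotheses (rel0 : rel 0 0)
  (relD : forall a b a' b', rel a b -> rel a' b' -> rel (a + a')%N (b + b')%N).
Implicit Types p q : {mpoly F[d]}.

(** [rel] compares degrees before and after a substitution: it becomes [b <= a] for affine maps and
    [a = b] for linear ones. *)
Definition degrees_rel k p := forall m, m \in msupp p -> rel k (mdeg m).

Lemma degrees_relM k l p q :
  degrees_rel k p -> degrees_rel l q -> degrees_rel (k + l) (p * q).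
Proof.
move=> hp hq m /msuppM_le/allpairsP [[m1 m2] /= [/hp h1 /hq h2 ->]].
by rewrite mdegD; apply: relD.
Qed.

Lemma degrees_rel_mmap1 (h : 'I_d -> {mpoly F[d]}) (m : 'X_{1..d}) :
  (forall i, degrees_rel 1 (h i)) -> degrees_rel (mdeg m) (mmap1 h m).
Proof.
move=> hh; rewrite /mmap1 mdegE.
apply: (big_ind2 (fun k p => degrees_rel k p)).
- by move=> u; rewrite msupp1 inE => /eqP ->; rewrite mdeg0.
- by move=> *; apply: degrees_relM.
- move=> i _; elim: (m i) => [|k IH].
    by rewrite expr0 => u; rewrite msupp1 inE => /eqP ->; rewrite mdeg0.
  by rewrite exprS -add1n; apply: degrees_relM.
Qed.

Lemma msupp_mmap_rel (h : 'I_d -> {mpoly F[d]}) p mu :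
  (forall i, degrees_rel 1 (h i)) ->
  mu \in msupp (mmap (@mpolyC d F) h p) ->
  exists2 m, m \in msupp p & rel (mdeg m) (mdeg mu).
Proof.
move=> hh /msupp_sum_le/flattenP [s /mapP [m]].
rewrite mem_filter /= => mp -> hmu; exists m => //.
by apply: (degrees_rel_mmap1 hh); move: hmu; rewrite mul_mpolyC => /msuppZ_le.
Qed.

End MonomialRelation.

Lemma mmap_mmap (F : fieldType) (d d' : nat) (S : comNzRingType)
    (f : {rmorphism F -> S}) (g : 'I_d -> {mpoly F[d']}) (h : 'I_d' -> S)
    (p : {mpoly F[d]}) :
  mmap f h (mmap (@mpolyC d' F) g p) = mmap f (fun j => mmap f h (g j)) p.
Proof.
rewrite [X in mmap f h X]/mmap raddf_sum /=; apply: eq_bigr => m _.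
by rewrite mul_mpolyC mmapZ /mmap1 rmorph_prod; under eq_bigr do rewrite rmorphXn.
Qed.

(** * Affine changes of coordinates *)

Section Taylor.
Variables (F : fieldType) (d : nat).
Implicit Types (f : {mpoly F[d]}) (p c : 'rV[F]_d) (B C : 'M[F]_d).

Definition affine p B (j : 'I_d) : {mpoly F[d]} :=
  (p 0 j)%:MP + \sum_i B i j *: 'X_i.

(* The polynomial [x |-> f (p + x B)]. *)
Definition taylor p B f := mmap (@mpolyC d F) (affine p B) f.

Lemma taylor_comp c C p B f :
  taylor c C (taylor p B f) = taylor (p + c *m B) (C *m B) f.
Proof.
rewrite /taylor mmap_mmap; apply: eq_bigr => m _; congr (_ * _).
apply: mmap1_eq => j; rewrite raddfD /= mmapC raddf_sum /=.
under eq_bigr do rewrite mmapZ mmapX mmap1U.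
rewrite /affine !mxE raddfD -addrA; congr (_ + _).
under eq_bigr do rewrite mulrDr.
rewrite big_split /=; congr (_ + _).
  by rewrite raddf_sum; apply: eq_bigr => i _; rewrite -mpolyCM mulrC.
under eq_bigr do rewrite mulr_sumr.
rewrite exchange_big; apply: eq_bigr => k _ /=.
rewrite mxE scaler_suml; apply: eq_bigr => i _.
by rewrite mul_mpolyC scalerA mulrC.
Qed.

Lemma affine1 p j : affine p 1%:M j = (p 0 j)%:MP + 'X_j.
Proof.
rewrite /affine (bigD1 j isT) /= mxE eqxx scale1r big1 ?addr0 //.
by move=> i ne; rewrite mxE (negPf ne) scale0r.
Qed.

Lemma taylor_id f : taylor 0 1%:M f = f.
Proof.
rewrite [RHS]mpolyE /taylor /mmap; apply: eq_bigr => m _.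
rewrite mul_mpolyC -mmap1_id; congr (_ *: _); apply: mmap1_eq => j.
by rewrite affine1 mxE mpolyC0 add0r.
Qed.

Lemma taylor_inj p B : B \in unitmx -> injective (taylor p B).
Proof.
move=> uB; apply: (can_inj (g := taylor (- p *m invmx B) (invmx B))) => f.
by rewrite taylor_comp -mulmxA mulVmx // mulmx1 addrN taylor_id.
Qed.

Lemma msupp_affine_le p B j m : m \in msupp (affine p B j) -> (mdeg m <= 1)%N.
Proof.
move/msuppD_le; rewrite mem_cat => /orP [|/msupp_sum_le/flattenP[s]].
  by rewrite msuppC; case: ifP => // _; rewrite inE => /eqP ->; rewrite mdeg0.
move=> /mapP [i _ ->] /msuppZ_le; rewrite msuppX inE => /eqP ->.
by rewrite mdeg1.
Qed.

Lemma msupp_affine0 B j m : m \in msupp (affine 0 B j) -> mdeg m = 1%N.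
Proof.
rewrite /affine mxE mpolyC0 add0r => /msupp_sum_le/flattenP[s].
move=> /mapP [i _ ->] /msuppZ_le; rewrite msuppX inE => /eqP ->.
by rewrite mdeg1.
Qed.

Lemma mdeg_taylor_le p B n f :
  {in msupp f, forall m, (mdeg m <= n)%N} ->
  {in msupp (taylor p B f), forall m, (mdeg m <= n)%N}.
Proof.
move=> hf m /(@msupp_mmap_rel _ _ (fun a b => (b <= a)%N)) [] //.
- by move=> *; apply: leq_add.
- by move=> j u; apply: msupp_affine_le.
- by move=> m' /hf h1 h2; apply: leq_trans h1.
Qed.

(** A linear substitution respects homogeneous parts, so a change of frame cannot lower the
    multiplicity at the origin. *)
Lemma mdeg_taylor0_ge B v f :
  {in msupp f, forall m, (v <= mdeg m)%N} ->
  {in msupp (taylor 0 B f), forall m, (v <= mdeg m)%N}.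
Proof.
move=> hf m /(@msupp_mmap_rel _ _ (fun a b => a = b)) [] //.
- by move=> a b a' b' -> ->.
- by move=> j u /msupp_affine0.
- by move=> m' /hf h1 <-.
Qed.

End Taylor.

(** * One-variable slices along a line *)

Section Slice.
Variables (F : fieldType) (d : nat) (i : 'I_d).
Implicit Types (f : {mpoly F[d]}) (m gam : 'X_{1..d}).

Definition mset m k : 'X_{1..d} := [multinom if j == i then k else m j | j < d].

Lemma mdeg_mset m k : (mdeg (mset m k) + m i = mdeg m + k)%N.
Proof.
rewrite !mdegE (bigD1 i) //= [in RHS](bigD1 i) //= mnmE eqxx.
rewrite (eq_bigr (fun j => m j)) => [|j /negPf ne]; last by rewrite mnmE ne.
by lia.
Qed.

Lemma mset_id m : mset m (m i) = m.
Proof. by apply/mnmP => j; rewrite mnmE; case: eqP => [->|]. Qed.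

Lemma eq_mset m gam k :
  (m == mset gam k) = (mset m 0 == mset gam 0) && (m i == k).
Proof.
apply/eqP/andP => [->|[/eqP/mnmP h /eqP <-]].
  split; last by rewrite mnmE eqxx.
  by apply/eqP/mnmP => j; rewrite !mnmE; case: eqP.
apply/mnmP => j; rewrite mnmE; case: eqP => [->//|/eqP/negPf ne].
by have := h j; rewrite !mnmE ne.
Qed.

Definition slice_var (t : F) (j : 'I_d) : {mpoly {poly F}[d]} :=
  if j == i then ('X - t%:P)%:MP else 'X_j.

(* Substituting [s - t] for the [i]-th variable of [f], this is the coefficient,
   a polynomial in [s], of the monomial [gam] in the other variables. *)
Definition slice t gam f : {poly F} :=
  (mmap (@mpolyC d {poly F} \o polyC) (slice_var t) f)@_(mset gam 0).

Lemma sliceE t gam f : slice t gam f =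
  \sum_(m <- msupp f | mset m 0 == mset gam 0) f@_m *: ('X - t%:P) ^+ m i.
Proof.
rewrite /slice /mmap raddf_sum [RHS]big_mkcond /=; apply: eq_bigr => m _.
have -> : mmap1 (slice_var t) m = (('X - t%:P) ^+ m i)%:MP * 'X_[mset m 0].
  rewrite /mmap1 mpolyXE_id (bigD1 i) //= [in RHS](bigD1 i) //=.
  rewrite /slice_var eqxx mnmE eqxx expr0 mul1r -rmorphXn; congr (_ * _).
  by apply: eq_bigr => j /negPf ne; rewrite ne mnmE ne.
rewrite mulrA -mpolyCM mul_mpolyC mcoeffZ mcoeffX.
by case: eqP; rewrite ?mulr1 ?mulr0 // mul_polyC.
Qed.

Lemma coef_slice0 gam f k : (slice 0 gam f)`_k = f@_(mset gam k).
Proof.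
rewrite sliceE coef_sum big_mkcond /=.
rewrite (eq_bigr (fun m => if m == mset gam k then f@_m else 0)).
  rewrite -big_mkcond /=; have [hin|hnin] := boolP (mset gam k \in msupp f).
    by rewrite -big_filter filter_pred1_uniq ?msupp_uniq // big_seq1.
  rewrite big_seq_cond big1 ?memN_msupp_eq0 // => m /andP[hm /eqP e].
  by rewrite -e hm in hnin.
move=> m _; rewrite (eq_mset m gam k) subr0 coefZ coefXn (eq_sym k).
by case: (_ == mset gam 0) => /=; case: (m i == k); rewrite ?mulr1 ?mulr0.
Qed.

Lemma size_slice0 gam f n :
  {in msupp f, forall m, (mdeg m <= n)%N} -> (size (slice 0 gam f) <= n.+1)%N.
Proof.
move=> hf; apply/leq_sizeP => k hk; rewrite coef_slice0 memN_msupp_eq0 //.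
apply/negP => /hf; rewrite leqNgt => /negP; apply.
have := mdeg_mset gam k; have : (gam i <= mdeg gam)%N.
  by rewrite mdegE (bigD1 i) //= leq_addr.
by lia.
Qed.

(** This lets a slice taken at one joint be computed from the expansion at another joint of the same
    line. *)
Lemma slice_shift t gam f :
  slice 0 gam (taylor (- t *: delta_mx 0 i) 1%:M f) = slice t gam f.
Proof.
pose emb : {rmorphism F -> {mpoly {poly F}[d]}} := @mpolyC d {poly F} \o polyC.
apply: (f_equal (mcoeff (mset gam 0))).
have E := mmap_mmap emb (affine (- t *: delta_mx 0 i) 1%:M) (slice_var 0) f.
etransitivity; first exact: E.
apply: eq_bigr => m _; congr (_ * _); apply: mmap1_eq => j.
rewrite affine1 raddfD /= mmapC mmapX mmap1U !mxE eqxx /slice_var.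
case: eqP => _.
  by rewrite mulr1 subr0 /emb /= -mpolyCD polyCN addrC.
by rewrite mulr0 /emb /= polyC0 mpolyC0 add0r.
Qed.

(** Monomials entering the slice agree with [gam] outside [i], so degree at least [v] forces their
    [i]-th exponent to be at least [v + gam i - mdeg gam]. *)
Lemma dvdp_slice t gam f v : {in msupp f, forall m, (v <= mdeg m)%N} ->
  ('X - t%:P) ^+ (v + gam i - mdeg gam) %| slice t gam f.
Proof.
move=> hf; rewrite sliceE big_seq_cond; apply: (big_ind (fun g => dvdp _ g)).
- exact: dvdp0.
- by move=> *; apply: dvdp_add.
- move=> m /andP[/hf hm /eqP e]; rewrite -mul_polyC.
  apply: dvdp_mull; apply: dvdp_exp2l.
  have := mdeg_mset m 0; have := mdeg_mset gam 0; rewrite e; lia.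
Qed.
End Slice.

(** * Zeros counted with multiplicity *)

Lemma size_prod_exp_XsubC (F : fieldType) (Q : eqType) (s : seq Q)
    (t : Q -> F) (e : Q -> nat) :
  \prod_(q <- s) ('X - (t q)%:P) ^+ e q \is monic /\
  size (\prod_(q <- s) ('X - (t q)%:P) ^+ e q) = (\sum_(q <- s) e q).+1.
Proof.
elim: s => [|q s [IHm IHs]]; first by rewrite !big_nil size_poly1 monic1.
have mq : ('X - (t q)%:P) ^+ e q \is monic by rewrite monic_exp ?monicXsubC.
rewrite !big_cons monicMl //; split => //.
by rewrite size_monicM ?monic_neq0 // size_exp_XsubC IHs addnS addSn.
Qed.

(** Powers of distinct linear factors are coprime, so their product divides [g]; [size g] is the
    degree plus one, hence the strict inequality. *)
Lemma sum_multiplicity_lt (F : fieldType) (Q : finType) (S : {pred Q})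
    (t : Q -> F) (e : Q -> nat) (g : {poly F}) :
  {in S &, injective t} -> g != 0 ->
  (forall q, q \in S -> ('X - (t q)%:P) ^+ e q %| g) ->
  (\sum_(q in S) e q < size g)%N.
Proof.
move=> t_inj g0 dvd; rewrite -big_enum /=.
have [_ <-] := size_prod_exp_XsubC (enum S) t e.
apply: dvdp_leq => //.
have : {subset enum S <= S} by move=> q; rewrite mem_enum.
elim: (enum S) (enum_uniq S) => [|q s IH] /=; first by rewrite big_nil dvd1p.
case/andP=> qs us sub; rewrite big_cons Gauss_dvdp ?dvd ?IH ?sub ?mem_head //.
  by move=> x xs; apply: sub; rewrite inE xs orbT.
apply: coprimep_expl; rewrite big_seq.
apply: (big_ind (fun h => coprimep _ h)) => [|x y|x xs].
- exact: coprimep1.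
- by rewrite coprimepMr => -> ->.
- apply: coprimep_expr; apply: coprimep_XsubC2; rewrite subr_eq0.
  apply: contraNneq qs => /t_inj <- //; last by apply: sub; rewrite mem_head.
  by apply: sub; rewrite inE xs orbT.
Qed.

(** * Prescribed vanishing by linear algebra *)

Lemma linear_dependence (F : fieldType) (S K : finType) (a : S -> K -> F) :
  (#|K| < #|S|)%N ->
  exists2 c : S -> F, (exists s, c s != 0) & forall k, \sum_s c s * a s k = 0.
Proof.
move=> lt; pose A := \matrix_(i < #|S|, j < #|K|) a (enum_val i) (enum_val j).
have : kermx A != 0.
  rewrite kermx_eq0 /row_free neq_ltn; apply/orP; left.
  exact: leq_ltn_trans (rank_leq_col A) lt.
move/rowV0Pn => [v /sub_kermxP vA /rV0Pn [i vi]].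
exists (fun s => v 0 (enum_rank s)); first by exists (enum_val i); rewrite enum_valK.
move=> k; have /rowP/(_ (enum_rank k)) := vA; rewrite !mxE => E; rewrite -[RHS]E.
rewrite (reindex (@enum_val S predT)) /=; last exact/onW_bij/enum_val_bij.
by apply: eq_bigr => j _; rewrite mxE enum_valK enum_rankK.
Qed.

Section Vanishing.
Variables (F : fieldType) (d n : nat) (J : finType) (T : {set J}).
Variables (pt : J -> 'rV[F]_d) (A : J -> 'M[F]_d) (b : J -> 'I_d -> nat).

(** Tuples, so that [card_partial_ord_partitions] counts these monomials as ['C(n + d, d)]. *)
Let exponents := {t : d.-tuple 'I_n.+1 | (\sum_(i <- t) (i : nat) <= n)%N}.
Let mon (s : exponents) : 'X_{1..d} := [multinom (tnth (val s) i : nat) | i < d].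
Let in_box (x : J * {ffun 'I_d -> 'I_n.+1}) :=
  (x.1 \in T) && [forall i, (x.2 i < b x.1 i)%N].

Let mon_inj : injective mon.
Proof.
move=> s s' /mnmP e; apply/val_inj/eq_from_tnth => i; apply/val_inj.
by have := e i; rewrite !mnmE.
Qed.

Let mdeg_mon s : (mdeg (mon s) <= n)%N.
Proof.
have := valP s; rewrite /= big_tuple mdegE => le.
by under eq_bigr do rewrite mnmE.
Qed.

Let card_box : (#|[pred x | in_box x]| <= \sum_(p in T) \prod_i b p i)%N.
Proof.
rewrite -sum1_card.
rewrite -(pair_big_dep (mem T)
  (fun p (g : {ffun 'I_d -> 'I_n.+1}) => [forall i, g i < b p i]%N)
  (fun _ _ => 1%N)) /=.
apply: leq_sum => p _; rewrite sum1_card.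
rewrite (@eq_card _ _ (family (fun i => [pred k : 'I_n.+1 | k < b p i]%N))).
  rewrite card_family foldrE big_image /=. apply: leq_prod => i _.
  exact: card_ord_lt.
by move=> g; apply/forallP/familyP.
Qed.

(** The unknowns are the coefficients of [f]; each point of a box gives one linear equation, and
    there are fewer equations than unknowns. *)
Lemma exists_vanishing : (\sum_(p in T) \prod_i b p i < 'C(n + d, d))%N ->
  exists f : {mpoly F[d]}, [/\ f != 0, {in msupp f, forall m, (mdeg m <= n)%N}
    & forall p gam, p \in T -> gam \in msupp (taylor (pt p) (A p) f) ->
        exists i, (b p i <= gam i)%N].
Proof.
move=> lt.
have [|c [s0 cs0] hc] := @linear_dependence F exponents {x | in_box x}
  (fun s k => (taylor (pt (val k).1) (A (val k).1) 'X_[mon s])@_[multinom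
     ((val k).2 i : nat) | i < d]).
  rewrite !card_sig; apply: leq_ltn_trans card_box _; apply: leq_trans lt _.
  rewrite addnC -card_partial_ord_partitions; apply: subset_leq_card.
  by apply/subsetP => t; rewrite !inE.
pose f : {mpoly F[d]} := \sum_s c s *: 'X_[mon s].
have fdeg : {in msupp f, forall m, (mdeg m <= n)%N}.
  move=> m /msupp_sum_le/flattenP [l /mapP [s _ ->]] /msuppZ_le.
  by rewrite msuppX inE => /eqP ->.
have tE p : taylor (pt p) (A p) f = \sum_s c s *: taylor (pt p) (A p) 'X_[mon s].
  rewrite /taylor /f raddf_sum /=; apply: eq_bigr => s _.
  by rewrite mmapZ mul_mpolyC.
exists f; split => // [|p gam pT gs].
  apply: contraNneq cs0 => /(f_equal (mcoeff (mon s0))).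
  rewrite mcoeff0 raddf_sum (bigD1 s0) //= big1 => [|s ne].
    by rewrite mcoeffZ mcoeffX eqxx mulr1 addr0 => ->.
  by rewrite mcoeffZ mcoeffX (inj_eq mon_inj) (negPf ne) mulr0.
apply/existsP; apply: contraTT gs; rewrite negb_exists => /forallP lt_b.
apply/negP => gs; have /= gn i : (gam i < n.+1)%N.
  have := mdeg_taylor_le fdeg gs; rewrite mdegE (bigD1 i) //=; lia.
pose k : J * {ffun 'I_d -> 'I_n.+1} := (p, [ffun i => Ordinal (gn i)]).
have kb : in_box k.
  by rewrite /in_box pT; apply/forallP => i; rewrite ffunE /= ltnNge.
have := hc (exist _ k kb); move: gs; rewrite mcoeff_msupp tE => /eqP nz h; apply: nz.
rewrite -[RHS]h raddf_sum; apply: eq_bigr => s _ /=; rewrite mcoeffZ.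
by congr (_ * _@__); apply/mnmP => i; rewrite mnmE ffunE.
Qed.

End Vanishing.

(** * The dimension bound *)

Lemma binomial_le_sum_prod (F : fieldType) (d n : nat) (J : finType)
    (T : {set J}) (pt : J -> 'rV[F]_d) (A : J -> 'M[F]_d)
    (on : J -> 'I_d -> pred J) (u : J -> nat) (b : J -> 'I_d -> nat) :
  injective pt -> (forall p, A p \in unitmx) ->
  (forall p i q, on p i q -> exists t, pt q = pt p + t *: row i (A p)) ->
  T != set0 ->
  (forall p i r, p \in T -> (b p i <= r)%N ->
     (n < \sum_(q in T | on p i q) (r + u p - u q))%N) ->
  ('C(n + d, d) <= \sum_(p in T) \prod_i b p i)%N.
Proof.
move=> pt_inj uA on_line /set0Pn [p0 p0T] many.
rewrite leqNgt; apply/negP => /(exists_vanishing pt A) [f [f0 fdeg fvan]].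
pose loc p := taylor (pt p) (A p) f.
have loc0 p : loc p != 0.
  apply: contraNneq f0 => h; apply/eqP/(taylor_inj (p := pt p) (uA p)).
  by rewrite [LHS]h /taylor raddf0.
(* [mlast] is a monomial of least degree, so [v p] is the multiplicity of [f] at [pt p]. *)
pose v p := mdeg (mlast (loc p)).
have vmin p m : m \in msupp (loc p) -> (v p <= mdeg m)%N.
  by move=> h; apply/lemc_mdeg/mlast_lemc.
have [p pT pmin] := arg_minnP (fun p => v p + u p)%N p0T.
pose gam := mlast (loc p).
have gs : gam \in msupp (loc p) by apply: mlast_supp.
have [i bi] := fvan p gam pT gs.
pose g := slice i 0 gam (loc p).
have g0 : g != 0.
  apply: contraTneq gs => h; rewrite mcoeff_msupp negbK.
  by rewrite -[in loc p]/(loc p) -{1}(mset_id i gam) -coef_slice0 -/g h coef0.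
have gn : (size g <= n.+1)%N by apply/size_slice0/mdeg_taylor_le.
have /fin_all_exists [t ht] q : exists t, on p i q -> pt q = pt p + t *: row i (A p).
  by case h: (on p i q); [have [t] := on_line _ _ _ h; exists t | exists 0].
have t_inj : {in [pred q | (q \in T) && on p i q] &, injective t}.
  move=> q q' /andP[_ /ht e] /andP[_ /ht e'] tt; apply: pt_inj.
  by rewrite e e' tt.
have dvd q : q \in [pred q | (q \in T) && on p i q] ->
    ('X - (t q)%:P) ^+ (v q + gam i - mdeg gam) %| g.
  case/andP => qT /ht e.
  (* [h] is [f] expanded at [q] along the axes of [p]; it differs from [loc q] by a linear change of
     frame only, so its order is still at least [v q]. *)
  pose h := taylor (t q *: delta_mx 0 i) 1%:M (loc p).
  have -> : g = slice i (t q) gam h.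
    rewrite -slice_shift /h taylor_comp !mulmx1 scaleNr addrN.
    by rewrite taylor_id.
  apply: dvdp_slice; have -> : h = taylor 0 (A p *m invmx (A q)) (loc q).
    rewrite /h /loc !taylor_comp !mul0mx addr0 mul1mx mulmxKV // e.
    by rewrite -scalemxAl -rowE.
  by apply: mdeg_taylor0_ge => m; apply: vmin.
(* Since [v p + u p] is minimal, the multiplicities sum to more than [n], while [g] has degree at
   most [n]. *)
have := sum_multiplicity_lt t_inj g0 dvd; rewrite ltnNge => /negP; apply.
apply: leq_trans gn _; apply: leq_trans (many p i (gam i) pT bi) _.
apply: leq_sum => q /andP[qT _]; have := pmin q qT; rewrite /v -/gam; lia.
Qed.

End Polynomials.

From mathcomp Require Import finmap all_classical all_reals all_analysis.

Local Open Scope classical_set_scope.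
Local Open Scope ring_scope.

(** * Lines and frames at a joint *)

Lemma line_directed (F : fieldType) (d : nat) (l : set 'rV[F]_d) p :
  is_line l -> l p -> exists a, l = [set x | x - p \in <[a]>%VS].
Proof.
case=> q [U [dimU ->]] /= pq; exists (vpick U).
have <- : U = <[vpick U]>%VS.
  apply/eqP; rewrite eq_sym eqEdim -memvE memv_pick dimU dim_vline vpick0.
  by rewrite -dimv_eq0 dimU.
apply/seteqP; split => x /= h.
  have -> : x - p = (x - q) - (p - q) by rewrite opprB addrA subrK.
  exact: memvB.
have -> : x - q = (x - p) + (p - q) by rewrite addrA subrK.
exact: memvD.
Qed.

Lemma dim_ortho (F : fieldType) (d : nat) (w : 'cV[F]_d) : w != 0 ->
  \dim (lker (linfun (mulmxr w : 'rV[F]_d -> 'rV[F]_1))) = d.-1.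
Proof.
move=> w0; set f := linfun _.
have := limg_ker_dim f fullv; rewrite capfv dimvf dim_matrix mul1r => dimE.
suff limg1 : \dim (f @: fullv) = 1%N by move: dimE; rewrite limg1 addn1 => /(congr1 predn).
apply/eqP; rewrite eqn_leq; apply/andP; split.
  by apply: leq_trans (dimvS (subvf _)) _; rewrite dimvf /= dim_matrix.
rewrite lt0n dimv_eq0; apply: contraNneq w0 => f0.
apply/eqP/matrixP => i j; rewrite mxE [j]ord1.
have : f (delta_mx 0 i) \in (f @: fullv)%VS by rewrite memv_img ?memvf.
rewrite f0 memv0 lfunE /= -rowE => /eqP/rowP/(_ 0); by rewrite !mxE.
Qed.

(** Were the directions dependent, a nonzero column of the cokernel would be a functional killing
    them all, and its kernel translated to [p] a hyperplane containing every [l i]. *)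
Lemma joint_frame (F : fieldType) (d : nat) (Lines : set (set 'rV[F]_d)) p :
  (forall l, Lines l -> is_line l) -> is_joint Lines p ->
  exists l : 'I_d -> set 'rV[F]_d, exists A : 'M[F]_d,
    [/\ injective l, forall i, Lines (l i), A \in unitmx
      & forall i, l i = [set x | x - p \in <[row i A]>%VS]].
Proof.
move=> hl [l [linj lL lp noH]]; exists l.
have /fin_all_exists [a ha] i : exists a, l i = [set x | x - p \in <[a]>%VS].
  by apply: line_directed (lp i); apply: hl.
exists (\matrix_i a i); split => // [|i]; last by rewrite rowK.
apply: contrapT => /negP nu; apply: noH.
have : cokermx (\matrix_i a i) != 0.
  by rewrite -mxrank_eq0 mxrank_coker subn_eq0 -ltnNge ltn_neqAle rank_leq_col
    -row_free_unit andbT in nu *.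
move=> w0; have [j wj] : exists j, col j (cokermx (\matrix_i a i)) != 0.
  apply/existsP; apply: contraNT w0; rewrite negb_exists => /forallP h.
  apply/eqP/matrixP => i j; have /negPn/eqP/colP/(_ i) := h j.
  by rewrite !mxE.
set w := col j _ in wj.
exists [set x | x - p \in lker (linfun (mulmxr w : 'rV[F]_d -> 'rV[F]_1))].
  by exists p, (lker (linfun (mulmxr w : 'rV[F]_d -> 'rV[F]_1))); rewrite dim_ortho.
move=> i x; rewrite ha /= => /vlineP [t ->]; rewrite memv_ker lfunE /=.
rewrite -scalemxAl -(rowK a i) -row_mul /w colE mulmxA mulmx_coker.
by rewrite mul0mx row0 scaler0.
Qed.

(** Stated for finite sets of joints because the finiteness of [joints Lines] is itself deduced from
    it. *)
Lemma fset_joints_bound (F : fieldType) (d : nat) (hd : (2 <= d)%N)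
    (L : nat) (Lines : set (set 'rV[F]_d)) (B : {fset 'rV[F]_d}) :
  (forall l, Lines l -> is_line l) -> (Lines #= `I_L)%card ->
  [set` B] `<=` joints Lines ->
  (d ^ d * #|` B| ^ d.-1 <= d`! * L ^ d)%N.
Proof.
move=> hl hL hB; have d0 : (0 < d)%N by apply: leq_trans hd.
have [B0|B0] := posnP #|` B|; first by rewrite B0 exp0n ?muln0 // -ltnS prednK.
have /card_set_bijP [f [fL f_inj _]] := hL.
have frame (p : B) : {lA : ('I_d -> set 'rV[F]_d) * 'M[F]_d |
    [/\ injective lA.1, forall i, Lines (lA.1 i), lA.2 \in unitmx
      & forall i, lA.1 i = [set x | x - val p \in <[row i lA.2]>%VS]]}.
  apply: cid; have [|l [A h]] := @joint_frame F d Lines (val p) hl.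
    by apply: hB => /=; apply: valP.
  by exists (l, A).
pose l p := (sval (frame p)).1; pose A p := (sval (frame p)).2.
have lL p i : Lines (l p i) by rewrite /l; case: (frame p) => ? [].
have l_inj p : injective (l p) by rewrite /l; case: (frame p) => ? [].
have uA p : A p \in unitmx by rewrite /A; case: (frame p) => ? [].
have lE p i : l p i = [set x | x - val p \in <[row i (A p)]>%VS].
  by rewrite /l /A; case: (frame p) => ? [].
(* [inord] requires a successor; the values stay below [L], so at most [L] lines are counted. *)
pose e p i : 'I_L.+1 := inord (f (l p i)).
have eE p i : e p i = f (l p i) :> nat by rewrite inordK // ltnS ltnW //; apply: fL.
have le_inj p i q j : e p i = e q j -> l p i = l q j.
  by move/(congr1 (@nat_of_ord _)); rewrite !eE => /f_inj; apply; rewrite inE.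
have e_inj p : injective (e p) by move=> i j /le_inj /l_inj.
have on_e p i q : on_line e (e p i) q -> exists t, val q = val p + t *: row i (A p).
  case/existsP => j /eqP /le_inj lpq.
  have : l q j (val q) by rewrite lE /= subrr mem0v.
  by rewrite lpq lE /= => /vlineP [t qp]; exists t; rewrite -qp addrC subrK.
have := @joints_bound d B _ e e_inj d0 _ [set: B]%SET.
rewrite cardsT -cardfE -card_gt0 cardsT -cardfE => /(_ _ B0) H.
apply: leq_trans (H _) _.
  move=> T n u b T0; apply: (@Polynomials.binomial_le_sum_prod F d n B T val A
    (fun p i => on_line e (e p i)) u b) => //; exact: val_inj.
rewrite leq_mul2l leq_expl ?orbT //; apply: leq_trans (card_ord_lt L.+1 L).
apply/subset_leq_card/fintype.subsetP => k; rewrite !inE.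
by case/exists_inP => p _ /existsP [i /eqP <-]; rewrite eE; apply: fL.
Qed.

(** * The bound over the reals *)

Lemma le_root_bound (R : realType) (d L N : nat) : (2 <= d)%N ->
  (d ^ d * N ^ d.-1 <= d`! * L ^ d)%N ->
  N%:R <= ((d.-1)`!%:R `^ ((d.-1)%:R)^-1 / d%:R)
          * L%:R `^ (d%:R / (d.-1)%:R) :> R.
Proof.
case: d => [|[|k]] // _ /=; set d := k.+2 => h.
have k0 : (k.+1)%:R != 0 :> R by rewrite pnatr_eq0.
rewrite -(@ler_pXn2r _ k.+1) ?nnegrE ?mulr_ge0 ?divr_ge0 ?powR_ge0 //.
rewrite !exprMn exprVn -!powR_mulrn ?powR_ge0 //.
rewrite -!powRrM mulVf // divfK // powRr1 // !powR_mulrn //.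
rewrite mulrAC ler_pdivlMr ?exprn_gt0 ?ltr0n // -!natrX -!natrM ler_nat.
rewrite -(@leq_pmul2l d) // -/d; move: h; rewrite [(d ^ d)%N]expnS [d`!]factS; lia.
Qed.

Theorem theorem1p3 (R : realType) (F : fieldType) (d : nat) (hd : (2 <= d)%N)
    (L : nat) (Lines : set (set 'rV[F]_d))
    (hlines : forall l, Lines l -> is_line l) (hL : (Lines #= `I_L)%card) :
  exists N : nat, (joints Lines #= `I_N)%card /\
    N%:R <= ((d.-1)`!%:R `^ ((d.-1)%:R)^-1 / d%:R)
            * L%:R `^ (d%:R / (d.-1)%:R) :> R.
Proof.
have bound := fset_joints_bound hd hlines hL.
have [N hN] : finite_set (joints Lines).
  apply: contrapT => /(infinite_set_fset (d`! * L ^ d).+1) [B /bound hB big].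
  have : (#|` B| <= d ^ d * #|` B| ^ d.-1)%N.
    apply: leq_trans (leq_pmull _ _); last by rewrite expn_gt0 (leq_trans _ hd).
    rewrite -[leqLHS]expn1; case: #|` B| => // n; rewrite leq_pexp2l //.
    by rewrite -ltnS prednK // ltnW.
  by move/leq_trans => /(_ _ hB); rewrite leqNgt big.
exists N; split => //; apply: le_root_bound => //.
rewrite -(card_fset_set hN); apply: bound; rewrite fset_setK //.
by apply/finite_setP; exists N.
Qed.
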